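(* For each regular uncountable cardinal $\kappa$ and each positive integer $n$, there exists an atomistic $(\vee,0)$-semilattice $L$ of breadth $n+1$ and cardinality $\kappa^{+n}$ such that $|\{y\in L : y\leq x\}|<\kappa$ for each $x\in L$.
   Context: $\kappa^{+n}$ denotes the $n$-th successor cardinal of $\kappa$. A $(\vee,0)$-semilattice is a join-semilattice with a least element $0$. An atom of a poset with least element $0$ is an element $p>0$ such that there is no $z$ with $0<z<p$. A poset with least element is atomistic if each of its elements is a join of atoms ($0$ being the empty join). For a positive integer $m$, a join-semilattice $S$ has breadth at most $m$ if for every nonempty finite subset $X$ of $S$ there exists a nonempty $Y\subseteq X$ with at most $m$ elements such that $\bigvee X=\bigvee Y$; equivalently, for all $x_i,y_i\in S$ ($0\le i\le m$), if $x_i\le y_j$ for all $i\ne j$ in $\{0,\dots,m\}$, then $x_i\le y_i$ for some $i\in\{0,\dots,m\}$. The breadth of $S$ is the least such $m$; so breadth $n+1$ means breadth at most $n+1$ but not at most $n$. *)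

(* Defs.v *)
From HB Require Import structures.
From mathcomp Require Import all_boot all_order finmap.
From mathcomp Require Import boolp wochoice classical_sets functions cardinality.

Set Implicit Arguments.
Unset Strict Implicit.
Unset Printing Implicit Defensive.

Local Open Scope classical_set_scope.
Local Open Scope card_scope.

Definition card_lt T U (A : set T) (B : set U) : bool :=
  (A #<= B) && (A #!= B).
Notation "A '#<' B" := (card_lt A B) (at level 79) : card_scope.

(* A cardinal is represented by any type having that cardinality.  The name
   [Card] keeps all these types in one universe, so that the minimality clause
   of [succ_card] ranges over the same types as its other arguments. *)
Definition Card := Type.

(* [R] is the (non-strict) order of the initial ordinal of [K]: a well-order
   all of whose proper initial segments are smaller than [K]. *)
Definition initial_well_order (K : Card) (R : rel K) : Prop :=
  well_order R /\ forall x : K, [set y | R y x /\ y <> x] #< [set: K].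

Definition cofinal_in (K : Card) (R : rel K) (A : set K) : Prop :=
  forall x : K, exists2 y, A y & R x y.

(* cf(K) = K, the cofinality being computed in the initial ordinal of [K] *)
Definition regular_cardinal (K : Card) : Prop :=
  infinite_set [set: K] /\
  exists R : rel K, initial_well_order R /\
    forall A : set K, cofinal_in R A -> A #= [set: K].

Definition uncountable_cardinal (K : Card) : Prop := ~ countable [set: K].

(* [M] is the successor cardinal of [K], the least cardinal above it *)
Definition succ_card (K M : Card) : Prop :=
  [set: K] #< [set: M] /\
  forall X : Card, [set: K] #< [set: X] -> [set: M] #<= [set: X].

(* the cardinality of [M] is the n-th successor cardinal of [K] *)
Fixpoint nth_succ_card (n : nat) (K M : Card) : Prop :=
  if n is m.+1 then exists2 N : Card, nth_succ_card m K N & succ_card N M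
  else [set: M] #= [set: K].

Section Semilattice.
Context {d : Order.disp_t} (L : bJoinSemilatticeType d).
Local Open Scope order_scope.

Definition is_atom (p : L) : Prop :=
  \bot < p /\ ~ exists z : L, \bot < z /\ z < p.

(* The set of atoms [A] may be infinite; for [A] empty the join is [\bot]. *)
Definition atomistic : Prop :=
  forall x : L, exists2 A : set L, A `<=` is_atom & supremums A x.

Definition breadth_at_most (m : nat) : Prop :=
  forall X : {fset L}, X != fset0 ->
    exists Y : {fset L},
      [/\ Y != fset0, (Y `<=` X)%fset, (#|` Y| <= m)%N
        & \join_(x <- X) x = \join_(y <- Y) y].

Definition has_breadth (m : nat) : Prop :=
  [/\ (0 < m)%N, breadth_at_most m
    & forall k : nat, (0 < k)%N -> breadth_at_most k -> (m <= k)%N].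

End Semilattice.

(* Main.v *)
(* By Kuratowski's theorem, on a set [M] of cardinality [K^{+n}] there is a set
   map [G] sending (n+1)-element subsets to sets smaller than [K], such that any
   n+2 elements include one lying in [G] of the others.  It is obtained by
   induction on [n]: send a finite subset of [M] with largest element [x] to a
   set of elements below [x], using an injection of the initial segment below
   [x] into the previous cardinal.
   Call a subset of [M] closed if it contains [G s] for each of its
   (n+1)-element subsets [s], and let [L] consist of the finitely generated
   closed sets.  Closures of small sets are small because [K] is regular and
   uncountable, breadth at most n+1 expresses the absence of free sets, and
   since subsets with at most [n] elements are closed, singletons are atoms and
   any n+1 of them are join-independent. *)
Require Import Defs.
From HB Require Import structures.
From mathcomp Require Import all_boot all_order finmap.
From mathcomp Require Import boolp wochoice classical_sets functions cardinality.

Set Implicit Arguments.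
Unset Strict Implicit.
Unset Printing Implicit Defensive.

Import Order.LTheory.

Local Open Scope classical_set_scope.
Local Open Scope card_scope.

(** * Cardinals and well-orders *)

(** Choice extracts a function from a total injective relation, so an embedding can be given without
    a map defined on all of [T] or a default value in [U]. *)
Lemma card_leRP T U (A : set T) (B : set U) :
  reflect (exists r : T -> U -> Prop,
             (forall x, A x -> exists2 y, B y & r x y) /\
             (forall x x' y, A x -> A x' -> r x y -> r x' y -> x = x'))
          (A #<= B).
Proof.
apply: (iffP idP) => [/card_leP[f]|[r [rAB r_inj]]].
  exists (fun x y => exists2 a : A, \val a = x & \val (f a) = y).
  split=> [x Ax|x x' _ _ _ [a <- <-] [a' <- /val_inj/inj]].
    exists (\val (f (exist _ x (mem_set Ax)))); first exact: set_valP.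
    by exists (exist _ x (mem_set Ax)).
  by move=> ->//; rewrite inE.
have [->|/set0P[x0 Ax0]] := eqVneq A set0; first exact: card_ge0.
have [y0 _ _] := rAB _ Ax0.
have [x|f rf] := @choice T U (fun x y => A x -> B y /\ r x y).
  by have [/rAB[y By rxy]|nAx] := pselect (A x); [exists y | exists y0].
have f_inj : {in A &, injective f}.
  move=> x x' /set_mem Ax /set_mem Ax' e.
  by apply: (r_inj x x' (f x)) => //; [case: (rf x Ax) | rewrite e; case: (rf x' Ax')].
apply: card_le_trans (subset_card_le (_ : f @` A `<=` B)).
  by have /card_eqPle[] := inj_card_eq f_inj.
by move=> _ [x Ax <-]; case: (rf x Ax).
Qed.

Lemma card_le_inj T U (A : set T) (B : set U) (f : T -> U) :
    (forall x, A x -> B (f x)) ->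
    (forall x x', A x -> A x' -> f x = f x' -> x = x') ->
  A #<= B.
Proof.
move=> fAB f_inj; apply/card_leRP; exists (fun x y => y = f x); split=> [x Ax|].
  by exists (f x) => //; apply: fAB.
by move=> x x' y Ax Ax' ->; apply: f_inj.
Qed.

Lemma card_le_injP T U (A : set T) (B : set U) (u0 : U) : A #<= B ->
  exists f : T -> U, (forall x, A x -> B (f x)) /\
    (forall x x', A x -> A x' -> f x = f x' -> x = x').
Proof.
move=> /card_leRP[r [rAB r_inj]].
have [x|f rf] := @choice T U (fun x y => A x -> B y /\ r x y).
  by have [/rAB[y By rxy]|nAx] := pselect (A x); [exists y | exists u0].
exists f; split=> [x /rf[]//|x x' Ax Ax' e].
by apply: (r_inj x x' (f x)) => //; [case: (rf x Ax) | rewrite e; case: (rf x' Ax')].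
Qed.

Definition strict_seg (W : Type) (R : rel W) (x : W) : set W :=
  [set y | R y x /\ y <> x].

(** * Well-orders and comparability of cardinals *)

Section WellOrder.
Context (W : Type) (R : rel W) (Rwo : well_order R).

Lemma wo_min (A : set W) : A !=set0 -> exists2 z, A z & forall x, A x -> R z x.
Proof.
move=> [x Ax]; have [|z [[/asboolP Az zmin] _]] := Rwo (A := fun x => `[< A x >]).
  by exists x; apply/asboolP.
by exists z => // y Ay; apply: zmin; apply/asboolP.
Qed.

Lemma wo_refl x : R x x.
Proof. by have [|_ -> /(_ x erefl)] := @wo_min [set x]; first by exists x. Qed.

Lemma wo_total x y : R x y \/ R y x.
Proof.
have [|z [] -> zmin] := @wo_min [set x; y]; first by exists x; left.
  by left; apply: zmin; right.
by right; apply: zmin; left.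
Qed.

Lemma wo_anti x y : R x y -> R y x -> x = y.
Proof.
move=> Rxy Ryx.
have [|z [_ zuniq]] := Rwo (A := fun z => `[< z = x \/ z = y >]).
  by exists x; apply/asboolP; left.
have xz : z = x.
  apply: zuniq; split; first by apply/asboolP; left.
  by move=> t /asboolP[] -> //; apply: wo_refl.
rewrite -xz; apply: zuniq; split; first by apply/asboolP; right.
by move=> t /asboolP[] -> //; apply: wo_refl.
Qed.

Lemma wo_trans x y z : R x y -> R y z -> R x z.
Proof.
move=> Rxy Ryz.
have [|m [[]|] -> mmin] := @wo_min [set x; y; z]; first by exists x; left; left.
- by apply: mmin; right.
- by rewrite (wo_anti Rxy (mmin x _)) //; left; left.
- by rewrite -(wo_anti Ryz (mmin y _)) //; left; right.
Qed.

Lemma wo_nle x y : ~ R x y -> strict_seg R x y.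
Proof.
move=> nRxy; split; first by have [] := wo_total x y.
by move=> yx; apply: nRxy; rewrite yx; apply: wo_refl.
Qed.

Lemma wo_wf : well_founded (fun y x => strict_seg R x y).
Proof.
move=> x; have [//|nAx] := pselect (Acc (fun y x => strict_seg R x y) x).
have [|z nAz zmin] := @wo_min [set z | ~ Acc (fun y x => strict_seg R x y) z].
  by exists x.
case: nAz; constructor => y [Ryz yz]; apply: contrapT => nAy.
by apply: yz; apply: wo_anti Ryz _; apply: zmin.
Qed.

(** Transfinite recursion along [W] lists distinct elements of [B]: either it never stops and embeds
    [W], or it stops at some [w] because all of [B] is already listed below [w]. *)
Lemma wo_dichotomy U (B : set U) :
  [set: W] #<= B \/ exists w, B #<= strict_seg R w.
Proof.
pose F w (rec : forall v, strict_seg R w v -> option U) : option U :=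
  if pselect (exists u, B u /\ forall v p, rec v p <> Some u) is left e
  then Some (projT1 (cid e)) else None.
(* [h w] is an element of [B] not among the values [h v] for [v] below [w],
   and [None] when there is no such element. *)
pose h := Fix wo_wf (fun _ => option U) F.
have hE w : h w = F w (fun v _ => h v).
  apply: (Fix_eq wo_wf (fun _ => option U) F) => x f g fg.
  by congr F; apply: functional_extensionality_dep => y; apply: funext.
have hS w u : h w = Some u -> B u /\ forall v, strict_seg R w v -> h v <> Some u.
  by rewrite hE /F; case: pselect => // e [<-]; case: (cid e).
have hN w u : h w = None -> B u -> exists2 v, strict_seg R w v & h v = Some u.
  rewrite hE /F; case: pselect => // ne _ Bu; apply: contrapT => nex.
  by apply: ne; exists u; split=> // v p hv; apply: nex; exists v.
have [hfull|] := pselect (forall w, h w <> None).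
  left; apply/card_leRP; exists (fun w u => h w = Some u); split=> [w _|].
    by case hw : (h w) (hfull w) => [u|//] _; exists u => //; have [] := hS _ _ hw.
  move=> x x' u _ _ hx hx'; apply: wo_anti; apply: contrapT => /wo_nle seg.
    by have [_ /(_ x' seg)] := hS _ _ hx.
  by have [_ /(_ x seg)] := hS _ _ hx'.
move=> /existsNP[w] /contrapT hw; right; exists w; apply/card_leRP.
exists (fun u v => h v = Some u); split=> [u Bu|u u' v _ _ -> []//].
by have [v] := hN _ _ hw Bu; exists v.
Qed.

End WellOrder.

Lemma card_le_total T U (B : set U) : [set: T] #<= B \/ B #<= [set: T].
Proof.
have [R Rwo] := well_ordering_principle {classic T}.
have [|[w le]] := @wo_dichotomy {classic T} R Rwo U B; first by left.
by right; apply: card_le_trans le (card_leT _).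
Qed.

Lemma card_ltNge T U (A : set T) : (A #< [set: U]) = ~~ ([set: U] #<= A).
Proof.
rewrite /card_lt card_eq_le; have [->|->] := @card_le_total U T A.
  by rewrite andbT andbN.
by case: ([set: U] #<= A).
Qed.

Lemma Cantor_powerset T : ~ ([set: set T] #<= [set: T]).
Proof.
move=> /card_leRP[r [rT r_inj]].
pose D := [set x : T | exists2 A : set T, r A x & ~ A x].
have [x _ rDx] := rT D I; have [Dx|nDx] := pselect (D x).
  by have [A rAx] := Dx; rewrite (r_inj A D x).
by apply: (nDx); exists D.
Qed.

(** Order [S] by [phi], breaking ties by any well-order of [S]. If [S] did not embed in [M], then
    [M] would embed in a proper segment of [S], below some [t], hence in the set of [s] with
    [R (phi s) (phi t)]. *)
Lemma card_le_fibers S M (R : rel M) (phi : S -> M) : well_order R ->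
  (forall x, ~ ([set: M] #<= [set s | R (phi s) x])) -> [set: S] #<= [set: M].
Proof.
move=> Rwo small.
have [R' R'wo] := well_ordering_principle {classic S}.
pose Q (s t : S) := `[< (phi s <> phi t /\ R (phi s) (phi t)) \/
                       (phi s = phi t /\ R' s t) >].
have Qwo : well_order Q.
  apply: antisymmetric_well_order => [s t /andP[/asboolP[] [e Rst] /asboolP[] []]|A [s As]].
  - by move=> _ Rts; case: e; apply: (wo_anti Rwo).
  - by move=> e'; case: e.
  - by rewrite e.
  - by move=> _; apply: (wo_anti R'wo).
  have [|x [t At <-] xmin] := @wo_min M R Rwo (phi @` [set s | s \in A]).
    by exists (phi s); exists s.
  have [|m [Am phim] mmin] := @wo_min S R' R'wo [set s | s \in A /\ phi s = phi t].
    by exists t.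
  exists m; split=> // u Au; apply/asboolP.
  have [e|ne] := pselect (phi m = phi u); [right|left]; split=> //.
    by apply: mmin; split=> //; rewrite -e.
  by rewrite phim; apply: xmin; exists u.
have [//|[t Mle]] := wo_dichotomy Qwo [set: M].
case: (small (phi t)); apply: card_le_trans Mle (subset_card_le _) => s /= [/asboolP[] [e Rst] _] //.
by rewrite e; apply: wo_refl.
Qed.

(** * Finite sequences and regular cardinals *)

Lemma card_le_lt T U V (A : set T) (B : set U) :
  A #<= B -> B #< [set: V] -> A #< [set: V].
Proof. by rewrite !card_ltNge => AB; apply: contra => /card_le_trans; apply. Qed.

Definition seqs (T : choiceType) (A : set T) : set (seq T) :=
  [set s | [set` s] `<=` A].

Lemma seqs_cons (T : choiceType) (A : set T) x s :
  seqs A (x :: s) <-> A x /\ seqs A s.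
Proof.
split=> [sA|[Ax sA] y /=].
  by split=> [|y ys]; apply: sA; rewrite /= in_cons ?eqxx ?ys ?orbT.
by rewrite in_cons => /predU1P[->|/sA].
Qed.

Lemma card_le_seqs (T U : choiceType) (A : set T) (B : set U) :
  A #<= B -> seqs A #<= seqs B.
Proof.
have [-> _|/set0P[x0 Ax0] AB] := eqVneq A set0.
  apply: (@card_le_inj _ _ _ _ (fun _ => [::])); first by move=> s _ y.
  move=> [|x s] [|x' s'] // => [_ /seqs_cons[]|/seqs_cons[]|/seqs_cons[]] //.
have /card_leRP[r [/(_ _ Ax0)[u0 _ _] _]] := AB.
have [f [fAB f_inj]] := card_le_injP u0 AB.
apply: (@card_le_inj _ _ _ _ (map f)).
  by move=> s sA _ /mapP[x xs ->]; apply/fAB/sA.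
elim=> [|x s IHs] [|x' s'] // /seqs_cons[Ax sA] /seqs_cons[Ax' sA'] [e es].
by rewrite (f_inj x x') // (IHs s').
Qed.

Section Regular.
Context (K : Card) (Kreg : regular_cardinal K).

(* If [K] injects into the union, then each [F i] catches a subset of [K] that
   is not cofinal, hence is bounded by some [b i]; as [D] is small the [b i]
   are bounded too, hence so is [K]. *)
Lemma regular_bigcup I T (D : set I) (F : I -> set T) :
  D #< [set: K] -> (forall i, D i -> F i #< [set: K]) ->
  \bigcup_(i in D) F i #< [set: K].
Proof.
have [Kinf [R [[Rwo _] Rreg]]] := Kreg.
have bnd (A : set K) : A #< [set: K] -> exists x, forall y, A y -> ~ R x y.
  move=> /andP[_ /negP ne]; apply: contrapT => nex; apply: ne; apply: Rreg => x.
  by apply: contrapT => nx; apply: nex; exists x => y Ay Rxy; apply: nx; exists y.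
have [k0 _] := infinite_setN0 Kinf.
move=> Dlt Flt; rewrite card_ltNge; apply/negP => /card_leRP[r [rK r_inj]].
pose P i := [set k | exists2 u, F i u & r k u].
have PF i : P i #<= F i.
  apply/card_leRP; exists r; split=> [k [u]|k k' u _ _]; first by exists u.
  exact: r_inj.
have [i|b bP] := @choice I K (fun i x => D i -> forall y, P i y -> ~ R x y).
  have [Di|nDi] := pselect (D i); last by exists k0.
  by have [x xP] := bnd _ (card_le_lt (PF i) (Flt i Di)); exists x.
have [x xP] := bnd _ (card_le_lt (card_image_le b D) Dlt).
have [u [i Di Fu] rxu] := rK x Logic.I.
have := bP i Di x; have := xP (b i).
have [Rxb /(_ (imageP _ Di))//|Rbx _ /(_ _ Rbx)[]] := wo_total Rwo x (b i).
by exists u.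
Qed.

Context (Kunc : uncountable_cardinal K).

Lemma countable_lt T (A : set T) : countable A -> A #< [set: K].
Proof.
move=> /card_le_lt; apply; rewrite card_ltNge; apply/negP => Kle.
exact: Kunc.
Qed.

(** Lists of a fixed length are few by induction, as a union indexed by the head; since [K] is
    uncountable, the union over all lengths is still small. *)
Lemma regular_seqs (T : choiceType) (A : set T) :
  A #< [set: K] -> seqs A #< [set: K].
Proof.
move=> Alt; pose S k := [set s : seq T | size s = k /\ seqs A s].
apply: (@card_le_lt _ _ _ _ (\bigcup_(k in [set: nat]) S k)).
  by apply: subset_card_le => s sA; exists (size s).
apply: regular_bigcup => [|k _]; first exact/countable_lt/countableP.
elim: k => [|k IHk].
  apply: (@card_le_lt _ _ _ _ [set [::] : seq T]); last exact/countable_lt/countable1.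
  by apply: subset_card_le => -[|x s] [].
apply: (@card_le_lt _ _ _ _ (\bigcup_(x in A) [set x :: s | s in S k])).
  apply: subset_card_le => -[|x s] [] //= [ss] /seqs_cons[Ax sA].
  by exists x => //; exists s.
apply: regular_bigcup => // x Ax.
exact: card_le_lt (card_image_le _ _) IHk.
Qed.

End Regular.

Lemma wo_seq_ub (T : choiceType) (R : rel T) (x0 : T) (s : seq T) : well_order R ->
  exists2 x, s = [::] \/ x \in s & forall y, y \in s -> R y x.
Proof.
move=> Rwo; elim: s => [|y s [x xs xub]]; first by exists x0; [left|].
have [Rxy|Ryx] := wo_total Rwo x y.
  exists y => [|z]; first by right; rewrite mem_head.
  rewrite in_cons => /predU1P[->|/xub Rzx]; first exact: wo_refl.
  exact: wo_trans Rxy.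
case: xs => [s0|xs].
  exists y => [|z]; first by right; rewrite mem_head.
  by rewrite s0 inE => /eqP ->; apply: wo_refl.
exists x => [|z]; first by right; rewrite in_cons xs orbT.
by rewrite in_cons => /predU1P[->|/xub].
Qed.

(** Send each list to an upper bound of its entries: lists sent below [x] have all entries below
    [x], so [card_le_fibers] applies. *)
Lemma card_seq_le (T : choiceType) (R : rel T) (x0 : T) : well_order R ->
  (forall x, ~ ([set: T] #<= seqs [set y | R y x])) -> [set: seq T] #<= [set: T].
Proof.
move=> Rwo small.
have [s|phi phiub] := @choice (seq T) T (fun s x => forall y, y \in s -> R y x).
  by have [x _ xub] := wo_seq_ub x0 s Rwo; exists x.
apply: (@card_le_fibers _ _ R phi Rwo) => x /card_le_trans Tle.
apply: (small x); apply: Tle; apply: subset_card_le => s /= Rsx y ys.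
exact: wo_trans (phiub _ _ ys) Rsx.
Qed.

(** * Successor cardinals *)

Lemma succ_card_eq (N M M' : Card) :
  [set: M'] #= [set: M] -> succ_card N M -> succ_card N M'.
Proof.
move=> e [NM Mmin]; split=> [|X NX].
  by move: NM; rewrite !card_ltNge (card_le_eql e).
by rewrite (card_le_eql e); apply: Mmin.
Qed.

Lemma nth_succ_card_eq n (K M M' : Card) :
  [set: M'] #= [set: M] -> nth_succ_card n K M -> nth_succ_card n K M'.
Proof.
case: n => [e /= eM|n e [N KN NM]]; first exact: card_eq_trans eM.
by exists N => //; apply: succ_card_eq NM.
Qed.

(** A set larger than [N] cannot embed in a proper segment of [M], so by [wo_dichotomy] it receives
    an embedding of [M]. *)
Lemma wo_succ_card (N M : Card) (R : rel M) : well_order R ->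
    ~ ([set: M] #<= [set: N]) ->
    (forall x, strict_seg R x #<= [set: N]) ->
  succ_card N M.
Proof.
move=> Rwo nMN segN; split=> [|X]; first by rewrite card_ltNge; apply/negP.
rewrite card_ltNge => /negP nXN; have [//|[x Xle]] := wo_dichotomy Rwo [set: X].
by case: nXN; apply: card_le_trans Xle (segN x).
Qed.

(* [M] is either all of [set N], or its least initial segment larger than [N]. *)
Lemma succ_card_exists (N : Card) : exists (M : Card) (R : rel M),
  [/\ well_order R, ~ ([set: M] #<= [set: N]) &
      forall x, strict_seg R x #<= [set: N]].
Proof.
have [R Rwo] := well_ordering_principle {classic (set N)}.
have [segN|] := pselect (forall x, strict_seg R x #<= [set: N]).
  by exists (set N), R; split=> //; apply: Cantor_powerset.
move=> /existsNP[x nxN].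
have [|a naN amin] := wo_min Rwo (A := [set a | ~ (strict_seg R a #<= [set: N])]).
  by exists x.
pose M := {y : {classic (set N)} | strict_seg R a y}.
pose Q (y z : M) := R (sval y) (sval z).
have sval_inj (y z : M) : sval y = sval z -> y = z.
  by case: y z => [y ya] [z za] /= e; apply: eq_exist.
exists M, Q; split=> [||y].
- apply: antisymmetric_well_order => [y z /andP[yz zy]|A [y Ay]].
    exact/sval_inj/(wo_anti Rwo).
  have [|_ [z Az <-] zmin] := wo_min Rwo (A := @sval _ _ @` [set z | z \in A]).
    by exists (sval y), y.
  by exists z; split=> // t At; apply: zmin; exists t.
- move=> MN; apply: naN; apply: card_le_trans MN; apply/card_leRP.
  exists (fun y z => y = sval z); split=> [y ya|y y' z _ _ -> //].
  by exists (exist _ y ya).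
- case: y => y [Rya nya]; have : strict_seg R y #<= [set: N].
    apply: contrapT => nyN; apply: nya; apply: (wo_anti Rwo) => //.
    exact: amin.
  apply: card_le_trans; apply: (@card_le_inj _ _ _ _ (fun z => sval z)).
    by move=> z [Qzy nzy]; split=> // e; apply/nzy/sval_inj.
  by move=> z z' _ _; apply: sval_inj.
Qed.
(** * Set maps without free sets *)

(* In Kuratowski's terms: [G] is a set map of order [K] on the [m.+1]-element
   subsets of [T] with no free set of [m.+2] elements. *)
Definition kuratowski_map (K : Card) (m : nat) (T : choiceType)
    (G : seq T -> set T) : Prop :=
  (forall s, G s #< [set: K]) /\
  forall s, uniq s -> size s = m.+2 -> exists2 x, x \in s & G (rem x s) x.

Lemma rem_map_in (T U : eqType) (f : T -> U) (x : T) (s : seq T) :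
  {in s &, injective f} -> x \in s -> rem (f x) (map f s) = map f (rem x s).
Proof.
elim: s => //= y s IHs f_inj xys; case: (eqVneq y x) => [->|yx].
  by rewrite eqxx.
have ne : f y != f x.
  by apply: contra_neq yx => /f_inj; apply=> //; rewrite in_cons eqxx.
rewrite (negbTE ne) /= IHs //; last by move: xys; rewrite in_cons eq_sym (negbTE yx).
by move=> a b sa sb; apply: f_inj; rewrite in_cons ?sa ?sb orbT.
Qed.

Lemma remC (T : eqType) (x y : T) (s : seq T) :
  uniq s -> rem x (rem y s) = rem y (rem x s).
Proof.
move=> us; rewrite !rem_filter ?filter_uniq // -!filter_predI.
by apply: eq_filter => z /=; rewrite andbC.
Qed.

Section Kuratowski.
Context (K : Card) (Kreg : regular_cardinal K) (Kunc : uncountable_cardinal K).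

Lemma segment_lt (R : rel K) x : initial_well_order R ->
  [set y | R y x] #< [set: K].
Proof.
(* A strict segment plus one point, written as a union over [bool] so that [regular_bigcup]
   applies. *)
move=> [_ segR]; apply: (@card_le_lt _ _ _ _
  (\bigcup_(b in [set: bool]) if b then strict_seg R x else [set x])).
  apply: subset_card_le => y Ryx.
  by have [->|ne] := pselect (y = x); [exists false | exists true].
apply: (regular_bigcup Kreg) => [|[] _]; last exact/(countable_lt Kunc)/countable1.
  exact/(countable_lt Kunc)/countableP.
exact: segR.
Qed.

(** Singletons go to closed initial segments: of two elements, the smaller lies in the segment of
    the larger. *)
Lemma kuratowski_map0 : exists G : seq {classic K} -> set {classic K},
  kuratowski_map K 0 G.
Proof.
have [_ [R [Rini _]]] := Kreg; have [Rwo _] := Rini.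
exists (fun s => if s is x :: _ then [set y | R y x] else set0).
split=> [[|x s]|[|a [|b []]]//]; first exact/(countable_lt Kunc)/countable0.
  exact: segment_lt.
rewrite /= inE andbT => ab _; have [Rab|Rba] := wo_total Rwo a b.
  by exists a; rewrite ?mem_head ?eqxx.
by exists b; rewrite ?in_cons ?eqxx ?orbT // (negbTE ab).
Qed.

(** If [x] is the largest element of [s], the rest of [s] is carried into [N] by the injection
    [f x], and the value at [s] is the part below [x] of the preimage of [G]. Among [m.+3] elements,
    freeness fails already for the images of those other than the largest. *)
Lemma kuratowski_mapS m (N M : choiceType) (n0 : N) (R : rel M)
    (G : seq N -> set N) :
    well_order R -> (forall x, strict_seg R x #<= [set: N]) ->
    kuratowski_map K m G ->
  exists H : seq M -> set M, kuratowski_map K m.+1 H.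
Proof.
move=> Rwo segN [Glt Gfree].
have [x|f fP] := @choice M (M -> N) (fun x f => forall y y',
    strict_seg R x y -> strict_seg R x y' -> f y = f y' -> y = y').
  by have [f [_ f_inj]] := card_le_injP n0 (segN x); exists f.
pose ismax x (s : seq M) := x \in s /\ forall z, z \in s -> R z x.
exists (fun s => [set y | exists2 x, ismax x s &
  strict_seg R x y /\ G (map (f x) (rem x s)) (f x y)]); split=> [s|s us ss].
  have [[x [xs xub]]|nomax] := pselect (exists x, ismax x s); last first.
    apply: card_le_lt (countable_lt Kunc (countable0 M)).
    by apply: subset_card_le => y [x xs _]; case: nomax; exists x.
  apply: card_le_lt (Glt (map (f x) (rem x s))).
  (* Uniqueness of the maximum leaves a single injection [f x], which embeds the new value in one
     value of [G]. *)
  have E x' : ismax x' s -> x' = x.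
    by move=> [x's x'ub]; apply: (wo_anti Rwo); [apply: xub | apply: x'ub].
  apply: (@card_le_inj _ _ _ _ (f x)) => [y [x' /E -> []//]|].
  by move=> y y' [_ /E -> [yx _]] [_ /E -> [y'x _]]; apply: fP.
have x0 : M by case: (s) ss.
have [x [s0|xs] xub] := wo_seq_ub x0 s Rwo; first by rewrite s0 in ss.
have ut : uniq (rem x s) by rewrite rem_uniq.
have tseg z : z \in rem x s -> strict_seg R x z.
  by rewrite mem_rem_uniq // inE => /andP[/eqP zx zs]; split=> //; apply: xub.
have f_inj : {in rem x s &, injective (f x)}.
  by move=> y z /tseg yx /tseg zx; apply: fP.
have [||_ /mapP[y yt ->]] := Gfree (map (f x) (rem x s)).
- by rewrite map_inj_in_uniq.
- by rewrite size_map size_rem // ss.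
(* Removing [y] leaves [x] as the maximum, so the new map at [rem y s] is computed with the same
   [f x]. *)
rewrite rem_map_in // remC // => Gy; exists y; first exact: mem_rem yt.
exists x; last by split=> //; apply: tseg.
split=> [|z /mem_rem/xub//].
rewrite mem_rem_uniq // inE xs andbT; apply/eqP => xy.
by have [_] := tseg y yt; rewrite xy.
Qed.

(** The bound on lists is part of the induction: lists over a segment of the next cardinal embed in
    lists over [N], hence in [N]. It later gives the cardinality of the semilattice. *)
Lemma nth_succ_card_kuratowski m : exists M : Card,
  [/\ nth_succ_card m K M, infinite_set [set: M],
      [set: seq {classic M}] #<= [set: M] &
      exists G : seq {classic M} -> set {classic M}, kuratowski_map K m G].
Proof.
elim: m => [|m [N [KN Ninf Nseq [G GP]]]].
  have [Kinf [R [Rini _]]] := Kreg; have [Rwo _] := Rini.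
  exists K; split=> //=; last exact: kuratowski_map0.
  have [x0 _] := infinite_setN0 Kinf.
  apply: (@card_seq_le {classic K} R x0) => // x.
  apply/negP; rewrite -card_ltNge; apply: (regular_seqs Kreg Kunc).
  exact: segment_lt.
have [M [R [Rwo nMN segN]]] := succ_card_exists N.
have Minf : infinite_set [set: M].
  apply/infiniteP; have [NM|//] := @card_le_total N M [set: M].
  exact: card_le_trans (iffLR (infiniteP _) Ninf) NM.
have [n0 _] := infinite_setN0 Ninf; have [x0 _] := infinite_setN0 Minf.
exists M; split=> //.
- by exists N => //; apply: wo_succ_card Rwo nMN segN.
- apply: (@card_seq_le {classic M} R x0) => // x Mle; apply: nMN.
  apply: card_le_trans Mle _; apply: card_le_trans (Nseq).
  apply: card_le_trans (card_leT _).
  apply: (@card_le_seqs {classic M} {classic N} _ [set: N]).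
  have [f [_ f_inj]] := card_le_injP n0 (segN x).
  apply: card_le_trans Nseq.
  (* The segment includes [x] itself, on which [f] is not controlled; the empty list provides a
     spare value for it. *)
  apply: (@card_le_inj _ _ _ _ (fun y => if `[< y = x >] then [::] else [:: f y])) => //.
  move=> y y' /= Ryx Ry'x; case: asboolP => [->|yx]; case: asboolP => [->|y'x] //.
  by case=> /f_inj; apply.
- exact: (@kuratowski_mapS m {classic N} {classic M} n0 R G).
Qed.

End Kuratowski.
(** * The semilattice of finitely generated closed sets *)

Section Closure.
Context (T : choiceType) (n : nat) (G : seq T -> set T).

(** As [G] reads lists, every enumeration of a subset is tested. *)
Definition Gclosed (C : set T) : Prop := forall s : seq T,
  uniq s -> size s = n.+1 -> [set` s] `<=` C -> G s `<=` C.

Definition closure_of (A : set T) : set T :=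
  \bigcap_(C in [set C | Gclosed C /\ A `<=` C]) C.

Lemma Gclosed_closure A : Gclosed (closure_of A).
Proof.
move=> s us ss sA x Gx C [Cc AC]; by apply: (Cc s us ss _ x Gx) => y /sA/(_ C (conj Cc AC)).
Qed.

Lemma sub_closure A : A `<=` closure_of A.
Proof. by move=> x Ax C [_]; apply. Qed.

Lemma closure_min A C : Gclosed C -> A `<=` C -> closure_of A `<=` C.
Proof. by move=> Cc AC x; apply. Qed.

Lemma closure_id C : Gclosed C -> closure_of C = C.
Proof.
by move=> Cc; apply/seteqP; split; [apply: closure_min | apply: sub_closure].
Qed.

(** The condition is vacuous: there are no [n.+1] distinct entries to test. *)
Lemma Gclosed_short (t : seq T) : (size t <= n)%N -> Gclosed [set` t].
Proof.
move=> tn s us ss /(uniq_leq_size us); rewrite ss => /leq_trans/(_ tn).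
by rewrite ltnn.
Qed.

(** The closure lies in the union of countably many stages, each small by regularity. This union is
    closed because a finite list lies in a single stage. *)
Lemma closure_lt (K : Card) (A : set T) :
    regular_cardinal K -> uncountable_cardinal K ->
    (forall s, G s #< [set: K]) -> A #< [set: K] ->
  closure_of A #< [set: K].
Proof.
move=> Kreg Kunc Glt Alt.
(* Values of [G] at all lists are added, which is harmless for an upper bound. *)
pose step B := \bigcup_(b in [set: bool])
  if b then B else \bigcup_(s in seqs B) G s.
pose S k := iter k step A.
have Slt k : S k #< [set: K].
  elim: k => [//|k IHk]; rewrite [S _]/(step (S k)) /step.
  apply: (regular_bigcup Kreg); first exact/(countable_lt Kunc)/countableP.
  move=> b _; case: b => //; apply: (regular_bigcup Kreg) => //.
  exact: regular_seqs.
have S_homo i j : (i <= j)%N -> S i `<=` S j.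
  move=> /subnK <-; elim: (j - i)%N => // k IHk x /IHk Sx.
  by exists true.
apply: (@card_le_lt _ _ _ _ (\bigcup_(k in [set: nat]) S k)); last first.
  by apply: (regular_bigcup Kreg) => //; exact/(countable_lt Kunc)/countableP.
apply: subset_card_le; apply: closure_min => [s us ss sS|x Ax]; last by exists 0%N.
have [k sk] : exists k, [set` s] `<=` S k.
  elim: s sS {us ss} => [_|y s IHs sS]; first by exists 0%N.
  have [|k sk] := IHs; first by move=> z zs; apply: sS; rewrite /= in_cons zs orbT.
  have [|l _ Sy] := sS y; first by rewrite /= mem_head.
  exists (maxn k l) => z /=; rewrite in_cons => /predU1P[->|/sk].
    exact: S_homo (leq_maxr k l) _ Sy.
  exact: S_homo (leq_maxl k l) _.
by move=> x Gx; exists k.+1 => //; exists false => //; exists s.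
Qed.

(** The boolean form of the predicate makes its proofs irrelevant, so elements are equal as soon as
    the underlying sets are. *)
Definition fin_closed : Type :=
  {C : set T | `[< exists s : seq T, C = closure_of [set` s] >]}.
HB.instance Definition _ := Choice.on fin_closed.

Implicit Types C D : fin_closed.

Lemma sval_fin_closed_inj C D : sval C = sval D -> C = D.
Proof. exact: val_inj. Qed.

Lemma fin_closedP C : exists s : seq T, sval C = closure_of [set` s].
Proof. exact/asboolP/(svalP C). Qed.

Lemma Gclosed_sval C : Gclosed (sval C).
Proof. by have [s ->] := fin_closedP C; apply: Gclosed_closure. Qed.

Definition generated (s : seq T) : fin_closed :=
  exist _ (closure_of [set` s]) (asboolT (ex_intro _ s erefl)).

Definition fc_le C D : bool := `[< sval C `<=` sval D >].

Fact fc_le_refl : reflexive fc_le.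
Proof. by move=> C; apply/asboolP. Qed.

Fact fc_le_anti : antisymmetric fc_le.
Proof.
move=> C D /andP[/asboolP CD /asboolP DC].
by apply: sval_fin_closed_inj; apply/seteqP.
Qed.

Fact fc_le_trans : transitive fc_le.
Proof.
by move=> D C E /asboolP CD /asboolP DE; apply/asboolP; apply: subset_trans DE.
Qed.

HB.instance Definition _ := Order.Le_isPOrder.Build set_display
  fin_closed fc_le_refl fc_le_anti fc_le_trans.

Lemma fc_leP C D : reflect (sval C `<=` sval D) (C <= D)%O.
Proof. exact: asboolP. Qed.

Lemma generated_le s C : (generated s <= C)%O <-> [set` s] `<=` sval C.
Proof.
split=> [/fc_leP sC|sC]; first exact: subset_trans (@sub_closure _) sC.
by apply/fc_leP; apply: closure_min => //; apply: Gclosed_sval.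
Qed.

Fact join_subproof C D : `[< exists s : seq T,
  closure_of (sval C `|` sval D) = closure_of [set` s] >].
Proof.
apply/asboolP; have [s es] := fin_closedP C; have [t et] := fin_closedP D.
exists (s ++ t); apply/seteqP; split.
  apply: closure_min; first exact: Gclosed_closure.
  rewrite es et subUset; split; apply: closure_min; try exact: Gclosed_closure.
    by move=> x xs; apply: sub_closure; rewrite /= mem_cat xs.
  by move=> x xt; apply: sub_closure; rewrite /= mem_cat xt orbT.
apply: closure_min => [|x /=]; first exact: Gclosed_closure.
rewrite mem_cat => /orP[xs|xt]; apply: sub_closure; [left|right].
  by rewrite es; apply: sub_closure.
by rewrite et; apply: sub_closure.
Qed.

Definition fc_join C D : fin_closed :=
  exist _ (closure_of (sval C `|` sval D)) (join_subproof C D).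

Fact fc_leUx C D E : (fc_join C D <= E)%O = (C <= E)%O && (D <= E)%O.
Proof.
apply/fc_leP/andP => [CDE|[/fc_leP CE /fc_leP DE]].
  have [CE DE] : sval C `<=` sval E /\ sval D `<=` sval E.
    by rewrite -subUset; apply: subset_trans CDE; apply: sub_closure.
  by split; apply/fc_leP.
by apply: closure_min; [apply: Gclosed_sval | rewrite subUset].
Qed.

HB.instance Definition _ := Order.POrder_isJoinSemilattice.Build
  set_display fin_closed fc_leUx.

Fact fc_le0x C : (generated [::] <= C)%O.
Proof. by apply/generated_le => x. Qed.

HB.instance Definition _ := Order.hasBottom.Build
  set_display fin_closed fc_le0x.

(** * Atoms and breadth *)

Lemma sval_generated_short s : (size s <= n)%N -> sval (generated s) = [set` s].
Proof. by move=> sn; rewrite /= closure_id //; apply: Gclosed_short. Qed.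

Lemma sval_generated1 x : (0 < n)%N -> sval (generated [:: x]) = [set x].
Proof. by move=> n0; rewrite sval_generated_short // set_cons1. Qed.

(** For [n] positive, both the empty set and [[set x]] are closed, and no set lies strictly between
    them. *)
Lemma generated1_atom x : (0 < n)%N -> is_atom (generated [:: x]).
Proof.
move=> n0; split.
  rewrite lt_neqAle le0x andbT.
  apply/eqP => /(congr1 (@sval _ _)) e.
  have : sval (Order.bottom : fin_closed) x by rewrite e sval_generated1.
  by rewrite sval_generated_short.
move=> [D [D0 Dx]]; move: (D0) (Dx); rewrite !lt_neqAle.
move=> /andP[/eqP nD0 _] /andP[/eqP nDx /fc_leP]; rewrite sval_generated1 // => sub.
have [Dx'|nDx'] := pselect (sval D x).
  apply: nDx; apply: sval_fin_closed_inj; rewrite sval_generated1 //.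
  by apply/seteqP; split=> // _ ->.
apply: nD0; apply: sval_fin_closed_inj; rewrite sval_generated_short // set_nil.
by apply/seteqP; split=> // y Dy; case: nDx'; rewrite -(sub y Dy).
Qed.

Lemma atomistic_fin_closed : (0 < n)%N -> atomistic fin_closed.
Proof.
move=> n0 C; exists [set generated [:: x] | x in sval C].
  by move=> _ [x _ <-]; apply: generated1_atom.
split=> [_ [x Cx <-]|D ubD].
  by apply/generated_le; rewrite set_cons1 => _ ->.
apply/fc_leP => x Cx; have /generated_le := ubD _ (imageP _ Cx).
by apply; rewrite /= mem_head.
Qed.

(* A family of [n.+2] closed sets none of which lies in the join of the others
   would have representatives contradicting [Gfree]. *)
Lemma breadth_le_fin_closed :
    (forall s, uniq s -> size s = n.+2 -> exists2 x, x \in s & G (rem x s) x) ->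
  breadth_at_most fin_closed n.+1.
Proof.
move=> Gfree X X0.
pose J (Y : {fset fin_closed}) := (\join_(y <- Y) y)%O.
(* A subfamily of least size with the same join is irredundant: no member lies below the join of the
   others. *)
pose P k := `[< exists Y : {fset fin_closed},
  [/\ Y != fset0, (Y `<=` X)%fset, J Y = J X & #|` Y| = k] >].
have exP : exists k, P k by exists #|` X|; apply/asboolP; exists X.
case: (ex_minnP exP) => k /asboolP[Y [Y0 YX JY kY]] kmin.
exists Y; split=> //; rewrite leqNgt; apply/negP => nY.
have irr C : C \in Y -> ~ (C <= J (Y `\ C)%fset)%O.
  move=> CY CJ; have cY : #|` Y| = #|` (Y `\ C)%fset|.+1.
    by rewrite (cardfsD1 C) CY.
  have : (k <= #|` (Y `\ C)%fset|)%N.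
    apply: kmin; apply/asboolP; exists (Y `\ C)%fset; split=> //.
    - by rewrite -cardfs_gt0 -ltnS -cY; apply: leq_ltn_trans nY.
    - exact: fsubset_trans (fsubD1set _ _) YX.
    - by rewrite -JY {2}/J (big_fsetD1 C) //=; apply/esym/join_idPr.
  by rewrite -kY cY ltnn.
(* The representative of [C] witnesses that [C] is not below the join of the other members; outside
   [Y], a point of [C0] serves as default. *)
have repr C : exists x, C \in Y -> sval C x /\ ~ sval (J (Y `\ C)%fset) x.
  have /fset0Pn[C0 C0Y] := Y0.
  have ex D : D \in Y -> exists x, sval D x /\ ~ sval (J (Y `\ D)%fset) x.
    move=> DY; apply: contrapT => nex; apply: (irr D DY); apply/fc_leP => x Dx.
    by apply: contrapT => nJx; apply: nex; exists x.
  have [CY|/negP nCY] := boolP (C \in Y); first by have [x] := ex C CY; exists x.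
  by have [x _] := ex _ C0Y; exists x.
have [g gP] := choice repr.
have gJ C D : C \in Y -> D \in Y -> C <> D -> sval (J (Y `\ D)%fset) (g C).
  move=> CY DY CD; have /fc_leP : (C <= J (Y `\ D)%fset)%O.
    by rewrite /J; apply: (joins_sup_seq id) => //; rewrite in_fsetD1 CY andbT; apply/eqP.
  by apply; have [] := gP C CY.
have g_inj : {in Y &, injective g}.
  move=> C D CY DY e; apply: contrapT => /(gJ _ _ CY DY); rewrite e.
  by have [] := gP D DY.
pose s := take n.+2 (enum_fset Y).
have sY C : C \in s -> C \in Y by apply: mem_take.
have us : uniq s by rewrite take_uniq // fset_uniq.
have ss : size s = n.+2 by rewrite size_takel.
have ugs : uniq (map g s).
  by rewrite map_inj_in_uniq // => C D /sY CY /sY; apply: g_inj.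
(* Some [g C] lies in [G] of the other representatives; these belong to the join of the members
   other than [C], which is closed and so would contain [g C]. *)
have [||_ /mapP[C Cs ->]] := Gfree (map g s) => //; first by rewrite size_map.
have [_ ngC] := gP C (sY _ Cs) => GgC; apply: ngC.
apply: (@Gclosed_sval (J (Y `\ C)%fset)) GgC.
- by rewrite rem_uniq.
- by rewrite size_rem ?size_map ?ss ?map_f.
- move=> x /=; rewrite mem_rem_uniq // inE => /andP[xC /mapP[D Ds xD]].
  by rewrite xD; apply: gJ; rewrite ?sY // => DC; rewrite xD DC eqxx in xC.
Qed.

(* Sets of at most [n] elements are closed, so [n.+1] atoms are join-independent. *)
Lemma breadth_ge_fin_closed k : infinite_set [set: T] ->
  (0 < n)%N -> breadth_at_most fin_closed k -> (n < k)%N.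
Proof.
move=> Tinf n0 bk; rewrite ltnNge; apply/negP => kn.
have [f f_inj] : exists f : nat -> T, injective f.
  have [x0 _] := infinite_setN0 Tinf.
  have /infiniteP/(card_le_injP x0)[f [_ f_inj]] := Tinf.
  by exists f => i j; apply: f_inj.
pose s := map f (iota 0 n.+1).
have us : uniq s by rewrite map_inj_uniq // iota_uniq.
pose single x := generated [:: x].
have single_inj x y : single x = single y -> x = y.
  move=> /(congr1 (@sval _ _)); rewrite !sval_generated1 // => e.
  by have : [set y] x by rewrite -e.
have [|Y [_ /fsubsetP YX Yk eJ]] := bk [fset single x | x in s]%fset.
  by apply/fset0Pn; exists (single (f 0)); apply/imfsetP; exists (f 0); rewrite //= mem_head.
(* [t] collects the points whose atoms are kept in [Y]. With at most [k <= n] entries it is closed,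
   so the join of [Y] adds no point, and all of [s] must already be in [t]. *)
pose t := [seq x <- s | single x \in Y].
have tk : (size t <= k)%N.
  apply: leq_trans Yk; rewrite -(size_map single); apply: uniq_leq_size.
    by rewrite map_inj_uniq ?filter_uniq.
  by move=> _ /mapP[x + ->]; rewrite mem_filter => /andP[].
have : (size s <= size t)%N.
  apply: uniq_leq_size => // x xs.
  have : (single x <= generated t)%O.
    apply: (@le_trans _ _ (\join_(y <- Y) y)%O).
      rewrite -eJ; apply: (joins_sup_seq id) => //.
      by apply/imfsetP; exists x.
    apply/joinsP_seq => C CY _; have /imfsetP[y /= ys eC] := YX C CY.
    rewrite eC; apply/generated_le; rewrite set_cons1 => _ ->.
    by apply: sub_closure; rewrite /= mem_filter ys andbT -eC.
  move=> /generated_le; rewrite set_cons1 sval_generated_short; first by apply.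
  exact: leq_trans kn.
rewrite size_map size_iota => /leq_trans/(_ tk) nk.
by have := leq_trans nk kn; rewrite ltnn.
Qed.

(** A closed set is determined by any generating list, whose entries it contains. This bounds both
    the whole semilattice and the principal ideals. *)
Lemma card_le_fin_closed (A : set T) :
  [set C : fin_closed | sval C `<=` A] #<= seqs A.
Proof.
apply/card_leRP; exists (fun C s => sval C = closure_of [set` s]).
split=> [C CA|C D s _ _ Cs Ds]; last by apply: sval_fin_closed_inj; rewrite Ds.
have [s Cs] := fin_closedP C; exists s => // x xs.
by apply: CA; rewrite Cs; apply: sub_closure.
Qed.

Lemma card_fin_closed : (0 < n)%N -> [set: seq T] #<= [set: T] ->
  [set: fin_closed] #= [set: T].
Proof.
move=> n0 seqT; apply/card_eqPle; split.
  apply: card_le_trans seqT; apply: card_le_trans (card_leT (seqs [set: T])).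
  by apply: card_le_trans (card_le_fin_closed _); apply: subset_card_le => C _ x.
apply: (@card_le_inj _ _ _ _ (fun x => generated [:: x])) => // x y _ _.
move=> /(congr1 (@sval _ _)); rewrite !sval_generated1 // => e.
by have : [set y] x by rewrite -e.
Qed.

End Closure.

Theorem theorem5p3 (K : Card) (n : nat) :
  regular_cardinal K -> uncountable_cardinal K -> (0 < n)%N ->
  exists (d : Order.disp_t) (L : bJoinSemilatticeType d),
    [/\ atomistic L,
        has_breadth L n.+1,
        nth_succ_card n K L
      & forall x : L, [set y : L | (y <= x)%O] #< [set: K]].
Proof.
move=> Kreg Kunc n0.
have [M [KM Minf Mseq [G [Glt Gfree]]]] := nth_succ_card_kuratowski Kreg Kunc n.
exists set_display, (fin_closed n G); split.
- exact: atomistic_fin_closed.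
- split=> // [|k _]; first exact: breadth_le_fin_closed.
  exact: breadth_ge_fin_closed.
- by apply: nth_succ_card_eq KM; apply: card_fin_closed.
(* Elements below [C] are counted by lists over [sval C], itself small as the closure of a finite
   set. *)
- move=> C; apply: (@card_le_lt _ _ _ _ (seqs (sval C))).
    apply: card_le_trans (@card_le_fin_closed _ n G _).
    by apply: subset_card_le => D /fc_leP.
  apply: (regular_seqs Kreg Kunc); have [s ->] := fin_closedP C.
  apply: closure_lt => //.
  exact/(countable_lt Kunc)/finite_set_countable/finite_seq.
Qed.
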